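(* Let $\mathcal A$ and $\mathcal D_{\mathcal A}$ be as in one of the four settings of the context, and let $f_1,\dots,f_m:\mathcal A\to[0,\infty)$ with Lovász extensions $f_1^L,\dots,f_m^L$ (in the same setting). Let $H:[0,\infty)^m\setminus\{\vec 0\}\to\mathbb R\cup\{+\infty\}$ be zero-homogeneous ($H(t\vec a)=H(\vec a)$ for $t>0$) with $H(\vec a+\vec b)\ge\min\{H(\vec a),H(\vec b)\}$ for all $\vec a,\vec b\in[0,\infty)^m\setminus\{\vec0\}$. Put $\mathrm{Dom}(H)=\{\vec a\in[0,\infty)^m\setminus\{\vec 0\}:H(\vec a)\in\mathbb R\}$, $\mathcal A'=\{A\in\mathcal A:(f_1(A),\dots,f_m(A))\in\mathrm{Dom}(H)\}$ and $\mathcal D'=\{\vec x\in\mathcal D_{\mathcal A}:(f_1^L(\vec x),\dots,f_m^L(\vec x))\in\mathrm{Dom}(H)\}$. Then $$\min_{A\in\mathcal A'}H(f_1(A),\dots,f_m(A))=\inf_{\vec x\in\mathcal D'}H(f_1^L(\vec x),\dots,f_m^L(\vec x)).$$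
   Context: Let $V=\{1,\dots,n\}$, $\mathcal P_2(V)=\{(A,B):A\cap B=\varnothing\}$, $V^t(\vec x)=\{i:x_i>t\}$, $V^t_\pm(\vec x)=\{i:\pm x_i>t\}$. Settings: (i) original: $\{\varnothing,V\}\subseteq\mathcal A\subseteq\mathcal P(V)$, $f^L(\vec x)=\int_{\min_ix_i}^{\max_ix_i}f(V^t(\vec x))dt+f(V)\min_ix_i$, $\mathcal D_{\mathcal A}=\{\vec x\in[0,\infty)^n:V^t(\vec x)\in\mathcal A\ \forall t\in\mathbb R\}$; (ii) disjoint-pair: $(\varnothing,\varnothing)\in\mathcal A\subseteq\mathcal P_2(V)$, $f^L(\vec x)=\int_0^{\|\vec x\|_\infty}f(V^t_+(\vec x),V^t_-(\vec x))dt$, $\mathcal D_{\mathcal A}=\{\vec x\in\mathbb R^n:(V^t_+(\vec x),V^t_-(\vec x))\in\mathcal A\ \forall t\ge0\}$; (iii) $k$-way, with $V_i=\{1,\dots,n_i\}$ and $\vec x=(\vec x^1,\dots,\vec x^k)$: $\{(\varnothing,\dots,\varnothing),(V_1,\dots,V_k)\}\subseteq\mathcal A\subseteq\prod_i\mathcal P(V_i)$, $f^L(\vec x)=\int_{\min\vec x}^{\max\vec x}f(V^t(\vec x^1),\dots,V^t(\vec x^k))dt+f(V_1,\dots,V_k)\min\vec x$, $\mathcal D_{\mathcal A}=\{\vec x\in[0,\infty)^{n_1+\cdots+n_k}:(V^t(\vec x^i))_{i=1}^k\in\mathcal A\ \forall t\}$; (iv) $k$-way disjoint-pair: $(\varnothing,\dots,\varnothing)\in\mathcal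 A\subseteq\prod_i\mathcal P_2(V_i)$, $f^L(\vec x)=\int_0^{\|\vec x\|_\infty}f(V^t_+(\vec x^1),V^t_-(\vec x^1),\dots,V^t_+(\vec x^k),V^t_-(\vec x^k))dt$, $\mathcal D_{\mathcal A}=\{\vec x:(V^t_+(\vec x^i),V^t_-(\vec x^i))_{i}\in\mathcal A\ \forall t\ge0\}$.
   Formalization: The formal theorem adds, in each setting, that the empty set (pair, tuple) is not in A' (implied by f_j(∅)=0); without it the identity fails, since f^L does not see f(∅), e.g. n=1, H(a,b)=b/(a+b), f(∅)=(1,0), f(V)=(0,1). *)

(* Defs.v *)
From HB Require Import structures.
From mathcomp Require Import all_boot all_order all_algebra.
From mathcomp Require Import all_classical all_reals all_analysis.

Set Implicit Arguments.
Unset Strict Implicit.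
Unset Printing Implicit Defensive.

Import Order.TTheory GRing.Theory Num.Theory.
Import numFieldNormedType.Exports.
Local Open Scope classical_set_scope.
Local Open Scope ring_scope.

(* The set {1, ..., n} is 'I_n.  A function on a family A of sets is given as a
   total function on the ambient finite type of sets; its values outside A are
   never used.  In the same way H is total on 'rV[R]_m and only its values on
   the punctured orthant are used. *)

Definition punctured_orthant (R : realType) (m : nat) (a : 'rV[R]_m) : bool :=
  [forall j, 0 <= a 0 j] && (a != 0).

Definition Dom (R : realType) (m : nat) (H : 'rV[R]_m -> \bar R)
    (a : 'rV[R]_m) : bool :=
  punctured_orthant a && (H a \is a fin_num).

Definition Aprime (R : realType) (m : nat) (H : 'rV[R]_m -> \bar R)
    (T : finType) (A : {set T}) (f : 'I_m -> T -> R) : {set T} :=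
  [set S in A | Dom H (\row_j f j S)]%SET.

Definition Dprime (R : realType) (m : nat) (H : 'rV[R]_m -> \bar R)
    (X : Type) (D : set X) (fL : 'I_m -> X -> R) : set X :=
  [set x | D x /\ Dom H (\row_j fL j x)].

(* Both sides are +oo when they range over the empty set; the left-hand side is
   a minimum over a finite set, hence attained as soon as that set is
   nonempty. *)
Definition min_eq_inf (R : realType) (m : nat) (H : 'rV[R]_m -> \bar R)
    (T : finType) (A : {set T}) (f : 'I_m -> T -> R)
    (X : Type) (D : set X) (fL : 'I_m -> X -> R) : Prop :=
  \big[Order.min/+oo%E]_(S in Aprime H A f) H (\row_j f j S) =
  ereal_inf [set H (\row_j fL j x) | x in Dprime H D fL].

Definition Vt (R : realType) (n : nat) (t : R) (x : 'rV[R]_n) : {set 'I_n} :=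
  [set i | t < x 0 i]%SET.

Definition Vtpm (R : realType) (n : nat) (t : R) (x : 'rV[R]_n) :
    {set 'I_n} * {set 'I_n} :=
  ([set i | t < x 0 i]%SET, [set i | t < - x 0 i]%SET).

Definition P2 (n : nat) : {set {set 'I_n} * {set 'I_n}} :=
  [set p : {set 'I_n} * {set 'I_n} | [disjoint p.1 & p.2]]%SET.

(* Original setting; V is nonempty since min x and max x are taken. *)

Definition min_coord (R : realType) (n : nat) (x : 'rV[R]_n.+1) : R :=
  \big[Num.min/x 0 ord0]_(i < n.+1) x 0 i.

Definition max_coord (R : realType) (n : nat) (x : 'rV[R]_n.+1) : R :=
  \big[Num.max/x 0 ord0]_(i < n.+1) x 0 i.

Definition lovasz (R : realType) (n : nat) (f : {set 'I_n.+1} -> R)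
    (x : 'rV[R]_n.+1) : R :=
  \int[lebesgue_measure]_(t in `[min_coord x, max_coord x]) f (Vt t x)
  + f [set: 'I_n.+1]%SET * min_coord x.

Definition lovasz_dom (R : realType) (n : nat) (A : {set {set 'I_n.+1}}) :
    set 'rV[R]_n.+1 :=
  [set x : 'rV[R]_n.+1 | (forall i, 0 <= x 0 i) /\ (forall t : R, Vt t x \in A)].

(* Disjoint-pair setting; `|x| is the sup norm on 'rV[R]_n. *)

Definition lovasz_pair (R : realType) (n : nat)
    (f : {set 'I_n} * {set 'I_n} -> R) (x : 'rV[R]_n) : R :=
  \int[lebesgue_measure]_(t in `[0, `|x|]) f (Vtpm t x).

Definition lovasz_pair_dom (R : realType) (n : nat)
    (A : {set {set 'I_n} * {set 'I_n}}) : set 'rV[R]_n :=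
  [set x : 'rV[R]_n | forall t : R, 0 <= t -> Vtpm t x \in A].

(* k-way settings: a point of R^(n_1 + ... + n_k) is a family of row vectors,
   a k-tuple of sets (or of disjoint pairs) a dependent finite function. *)

Definition ktuple (k : nat) (n : 'I_k -> nat) : finType :=
  {dffun forall i : 'I_k, {set 'I_(n i)}}.

Definition ktuple_pair (k : nat) (n : 'I_k -> nat) : finType :=
  {dffun forall i : 'I_k, ({set 'I_(n i)} * {set 'I_(n i)})%type}.

Definition kVt (R : realType) (k : nat) (n : 'I_k -> nat) (t : R)
    (x : forall i, 'rV[R]_(n i)) : ktuple n :=
  [ffun i : 'I_k => Vt t (x i)].

Definition kVtpm (R : realType) (k : nat) (n : 'I_k -> nat) (t : R)
    (x : forall i, 'rV[R]_(n i)) : ktuple_pair n :=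
  [ffun i : 'I_k => Vtpm t (x i)].

Definition kempty (k : nat) (n : 'I_k -> nat) : ktuple n :=
  [ffun i : 'I_k => finset.set0].

Definition kfull (k : nat) (n : 'I_k -> nat) : ktuple n :=
  [ffun i : 'I_k => [set: 'I_(n i)]%SET].

Definition kempty_pair (k : nat) (n : 'I_k -> nat) : ktuple_pair n :=
  [ffun i : 'I_k => (finset.set0, finset.set0)].

Definition kP2 (k : nat) (n : 'I_k -> nat) : {set ktuple_pair n} :=
  [set S : ktuple_pair n | [forall i, S i \in P2 (n i)]]%SET.

Definition kmin_coord (R : realType) (k : nat) (n : 'I_k.+1 -> nat)
    (x : forall i, 'rV[R]_(n i).+1) : R :=
  \big[Num.min/min_coord (x ord0)]_(i < k.+1) min_coord (x i).

Definition kmax_coord (R : realType) (k : nat) (n : 'I_k.+1 -> nat)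
    (x : forall i, 'rV[R]_(n i).+1) : R :=
  \big[Num.max/max_coord (x ord0)]_(i < k.+1) max_coord (x i).

Definition knorm (R : realType) (k : nat) (n : 'I_k -> nat)
    (x : forall i, 'rV[R]_(n i)) : R :=
  \big[Num.max/0]_(i < k) `|x i|.

Definition klovasz (R : realType) (k : nat) (n : 'I_k.+1 -> nat)
    (f : ktuple (fun i => (n i).+1) -> R)
    (x : forall i, 'rV[R]_(n i).+1) : R :=
  \int[lebesgue_measure]_(t in `[kmin_coord x, kmax_coord x]) f (kVt t x)
  + f (kfull (fun i => (n i).+1)) * kmin_coord x.

Definition klovasz_dom (R : realType) (k : nat) (n : 'I_k.+1 -> nat)
    (A : {set ktuple (fun i => (n i).+1)}) :
    set (forall i, 'rV[R]_(n i).+1) :=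
  [set x : forall i, 'rV[R]_(n i).+1 |
     (forall i j, 0 <= x i 0 j) /\ (forall t : R, kVt t x \in A)].

Definition klovasz_pair (R : realType) (k : nat) (n : 'I_k -> nat)
    (f : ktuple_pair n -> R) (x : forall i, 'rV[R]_(n i)) : R :=
  \int[lebesgue_measure]_(t in `[0, knorm x]) f (kVtpm t x).

Definition klovasz_pair_dom (R : realType) (k : nat) (n : 'I_k -> nat)
    (A : {set ktuple_pair n}) : set (forall i, 'rV[R]_(n i)) :=
  [set x : forall i, 'rV[R]_(n i) |
     forall t : R, 0 <= t -> kVtpm t x \in A].

(* Main.v *)
(* In each setting, the level set map t |-> V^t(x) takes finitely many values,
   all in A, so that f_j^L(x) = \sum_S w_S f_j(S) with weights w_S >= 0 supported
   on A that do not depend on j.  Zero-homogeneity and superminimality of H then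
   give some S in A' with H(f(S)) <= H(f^L(x)).  Conversely, the (signed)
   indicator vector of a nonempty S satisfies f_j^L(1_S) = f_j(S). *)

Require Import Defs.
From HB Require Import structures.
From mathcomp Require Import all_boot all_order all_algebra.
From mathcomp Require Import all_classical all_reals all_analysis.
From mathcomp Require Import measurable_realfun.

Set Implicit Arguments.
Unset Strict Implicit.
Unset Printing Implicit Defensive.

Import Order.TTheory GRing.Theory Num.Theory.
Import numFieldNormedType.Exports.
Local Open Scope classical_set_scope.
Local Open Scope ring_scope.

(** * Superminimal functions on the orthant and the reduction to weights *)

Lemma punctured_orthantZ (R : realType) (m : nat) (c : R) (a : 'rV[R]_m) :
  0 < c -> punctured_orthant (c *: a) = punctured_orthant a.
Proof.
move=> c0; rewrite /punctured_orthant scaler_eq0 gt_eqF//=; congr andb.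
by apply: eq_forallb => j; rewrite mxE pmulr_rge0.
Qed.

(** Induction on the sum: the smaller of [H] at the head and [H] at the tail is at most [H] of the
    total. Since [H_min] speaks only of nonzero rows, a zero head or a zero tail is discarded
    first. *)
Lemma superminimal_le_sum (R : realType) (m : nat) (H : 'rV[R]_m -> \bar R)
    (H_min : forall a b, punctured_orthant a -> punctured_orthant b ->
       (Order.min (H a) (H b) <= H (a + b)%R)%E)
    (I : Type) (s : seq I) (v : I -> 'rV[R]_m) :
  (forall i j, 0 <= v i 0 j) -> punctured_orthant (\sum_(i <- s) v i) ->
  exists i, punctured_orthant (v i) /\ (H (v i) <= H (\sum_(i <- s) v i)%R)%E.
Proof.
move=> v0; elim: s => [|i s IHs].
  by rewrite big_nil /punctured_orthant eqxx andbF.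
have po (w : 'rV[R]_m) : (forall j, 0 <= w 0 j) -> w != 0 -> punctured_orthant w.
  by move=> w0 wN0; rewrite /punctured_orthant wN0 andbT; apply/forallP.
have s0 j : 0 <= (\sum_(i <- s) v i) 0 j.
  by rewrite summxE; apply: sumr_ge0 => k _.
rewrite big_cons; have [->|viN0] := eqVneq (v i) 0; first by rewrite add0r.
have [->|sN0] := eqVneq (\sum_(i <- s) v i) 0.
  by rewrite addr0 => ?; exists i.
move=> _; have pi := po _ (v0 i) viN0; have ps := po _ s0 sN0.
have := H_min _ _ pi ps; rewrite ge_min => /orP[le_i|le_s]; first by exists i.
by have [k [pk le_k]] := IHs ps; exists k; split=> //; exact: le_trans le_s.
Qed.

(** A nonnegative measure on the finite type [T] carried by [A]; below, [S] is weighted by how long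
    the level set map stays equal to [S]. *)
Definition supported_weight (R : realType) (T : finType) (A : {set T})
    (w : T -> R) : Prop :=
  (forall S, 0 <= w S) /\ (forall S, S \notin A -> w S = 0).

(* [e] stands for the empty set, the only member of A whose indicator vector
   does not recover the value of f. *)
Lemma min_eq_inf_of_weights (R : realType) (m : nat) (H : 'rV[R]_m -> \bar R)
    (H_ninfty : forall a, punctured_orthant a -> H a != -oo%E)
    (H_homo : forall (t : R) a, 0 < t -> punctured_orthant a ->
       H (t *: a) = H a)
    (H_min : forall a b, punctured_orthant a -> punctured_orthant b ->
       (Order.min (H a) (H b) <= H (a + b)%R)%E)
    (T : finType) (A : {set T}) (f : 'I_m -> T -> R) (e : T)
    (X : Type) (D : set X) (fL : 'I_m -> X -> R) :
  (forall j S, S \in A -> 0 <= f j S) ->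
  e \notin Aprime H A f ->
  (forall x, D x -> exists2 w, supported_weight A w &
     forall j, fL j x = \sum_S w S * f j S) ->
  (forall S, S \in A -> S != e -> exists2 x, D x & forall j, fL j x = f j S) ->
  min_eq_inf H A f D fL.
Proof.
move=> f0 eA' weights point; apply/eqP; rewrite eq_le; apply/andP; split.
  apply: le_ereal_inf_tmp => _ [x [Dx]] /andP[px finx] <-.
  have [w [w0 wA] wE] := weights _ Dx.
  (* The weights do not depend on [j], so the whole row of extensions is a single nonnegative
     combination of the rows of values. *)
  have sumE : \row_j fL j x = \sum_S w S *: \row_j f j S.
    by apply/rowP => j; rewrite summxE !mxE wE; apply: eq_bigr => S _; rewrite !mxE.
  have v0 S j : 0 <= (w S *: \row_j f j S) 0 j.
    rewrite !mxE; have [SA|SA] := boolP (S \in A); last by rewrite wA ?mul0r.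
    by rewrite mulr_ge0 ?f0.
  rewrite sumE in px finx *.
  have [S [pS leS]] := superminimal_le_sum H_min v0 px.
  (* A zero weight would give the zero row, which lies outside the punctured orthant. *)
  have wN0 : w S != 0.
    by apply: contraTneq pS => ->; rewrite scale0r /punctured_orthant eqxx andbF.
  have wS : 0 < w S by rewrite lt_def wN0 w0.
  rewrite punctured_orthantZ// in pS; rewrite H_homo// in leS.
  (* The chosen [S] lies in [Aprime]: a nonzero weight forces it into [A], and [H] is finite there,
     being different from -oo and bounded by the finite value at [x]. *)
  apply: le_trans (leS); apply: bigmin_le_cond.
  rewrite inE (contra_neqT (wA S))//= /Dom pS/= fin_numE H_ninfty//=.
  by rewrite lt_eqF// (le_lt_trans leS)// ltey_eq finx.
(* Conversely, each [S] in [Aprime] differs from [e], so some point of [D] has the same row of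
   values and thus lies in [Dprime]. *)
apply: le_bigmin => [|S SA']; first exact: leey.
have Se : S != e by apply: contraNneq eA' => <-.
move: (SA'); rewrite inE => /andP[SA HS].
have [x Dx xE] := point _ SA Se.
have rowE : \row_j fL j x = \row_j f j S by apply/rowP => j; rewrite !mxE xE.
by apply: ereal_inf_lbound; exists x; rewrite ?rowE//; split; rewrite // rowE.
Qed.

(** * Integrals of functions of a finitely valued level set map *)

(** The fibres of [V] partition [D] into finitely many measurable pieces, on each of which the
    integrand is constant. Finiteness of [mu D] makes [fine] harmless on every piece. *)
Lemma Rintegral_finite_range d (X : measurableType d) (R : realType)
    (mu : {measure set X -> \bar R}) (T : finType) (D : set X) (V : X -> T)
    (f : T -> R) :
  measurable D -> (mu D < +oo)%E ->
  (forall S, measurable [set t | V t = S]) ->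
  \int[mu]_(t in D) f (V t) =
  \sum_S fine (mu (D `&` [set t | V t = S])) * f S.
Proof.
move=> mD muD mV; pose P S := D `&` [set t | V t = S].
have mP S : measurable (P S) by apply: measurableI.
have DE : D = \big[setU/set0]_(S <- enum T) P S.
  rewrite -bigcup_seq; apply/seteqP; split=> [t Dt|t [S _ []]//].
  by exists (V t); rewrite //= mem_enum.
have trivP : trivIset [set` enum T] P.
  by move=> S S' _ _ [t [[_ <-] [_ <-]]].
have mf : measurable_fun D (f \o V).
  move=> _ Y mY.
  rewrite (_ : _ `&` _ = \bigcup_(S in [set S | Y (f S)]) P S).
    by apply: fin_bigcup_measurable => //; exact: finite_finset.
  by apply/seteqP; split=> [t [Dt Yt]|t [S YS [Dt VS]]];
    [exists (V t)|split=> //=; rewrite VS].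
rewrite /Rintegral [X in integral mu X _]DE integral_bigsetU_EFin ?enum_uniq//;
  last by rewrite -DE; exact/measurable_EFinP.
have muP S : mu (P S) \is a fin_num.
  rewrite ge0_fin_numE//; apply: le_lt_trans muD.
  by apply: le_measure; rewrite ?inE//; apply: subIsetl.
rewrite (eq_bigr (fun S => (fine (mu (P S)) * f S)%:E)); last first.
  move=> S _; rewrite mulrC EFinM fineK// -integral_cst//.
  by apply: eq_integral => t; rewrite inE => -[_ /= ->].
by rewrite sumEFin /= big_enum.
Qed.

(** Each index cuts out a ray: [t < g i] if [i] is in [S], [g i <= t] otherwise. The fibre is the
    finite intersection of these rays. *)
Lemma measurable_superlevel (R : realType) (n : nat) (g : 'I_n -> R) S :
  measurable [set t : R | [set i | t < g i]%SET = S].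
Proof.
rewrite (_ : [set t | _] = \bigcap_(i in [set: 'I_n])
  [set` if i \in S then `]-oo, g i[ else `[g i, +oo[]).
  by apply: fin_bigcap_measurable => // i _; case: ifP.
apply/seteqP; split=> [t <- i _|t tS].
  by rewrite inE; case: ltP => /= ?; rewrite in_itv/= ?andbT.
apply/setP => i; rewrite inE; have := tS i I.
by case: (i \in S); rewrite /= in_itv/= ?andbT// leNgt => /negbTE.
Qed.

Lemma measurable_Vt (R : realType) (n : nat) (x : 'rV[R]_n) S :
  measurable [set t : R | Vt t x = S].
Proof. exact: measurable_superlevel. Qed.

Lemma measurable_Vtpm (R : realType) (n : nat) (x : 'rV[R]_n) S :
  measurable [set t : R | Vtpm t x = S].
Proof.
case: S => P N.
rewrite (_ : [set t | _] = [set t : R | [set i | t < x 0 i]%SET = P] `&`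
                           [set t : R | [set i | t < - x 0 i]%SET = N]).
  by apply: measurableI; exact: measurable_superlevel.
by apply/seteqP; split=> t; [case=> <- <-|case=> /= <- <-].
Qed.

Lemma measurable_dffun d (X : measurableType d) (k : nat)
    (T : 'I_k -> finType) (V : forall i, X -> T i) S :
  (forall i s, measurable [set t | V i t = s]) ->
  measurable [set t | [ffun i => V i t] = S :> {dffun forall i, T i}].
Proof.
move=> mV.
rewrite (_ : [set t | _] = \bigcap_(i in [set: 'I_k]) [set t | V i t = S i]).
  by apply: fin_bigcap_measurable => // i _.
apply/seteqP; split=> [t <- i _ /=|t tS]; first by rewrite ffunE.
by apply/ffunP => i; rewrite ffunE; exact: tS.
Qed.

(** The weight of [S] is the length of the part of the interval where [V t = S]; this part is empty
    for [S] outside [A]. *)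
Lemma level_integral_weights (R : realType) (T : finType) (A : {set T})
    (V : R -> T) (a b : R) :
  (forall S, measurable [set t | V t = S]) ->
  (forall t, t \in `[a, b] -> V t \in A) ->
  exists2 w, supported_weight A w & forall f : T -> R,
    \int[lebesgue_measure]_(t in `[a, b]) f (V t) = \sum_S w S * f S.
Proof.
move=> mV VA.
exists (fun S => fine (lebesgue_measure (`[a, b] `&` [set t | V t = S]))).
  split=> [S|S SA]; first exact: fine_ge0.
  rewrite (_ : _ `&` _ = set0) ?measure0//.
  by apply/seteqP; split=> // t [/VA VtA] /= VS; rewrite -VS VtA in SA.
move=> f; apply: Rintegral_finite_range => //.
by rewrite /= lebesgue_measure_itv/=; case: ifP => // _; rewrite -EFinB ltry.
Qed.

(** The boundary term is absorbed by adding [c] to the weight of [full]. *)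
Lemma level_integral_add_weights (R : realType) (T : finType) (A : {set T})
    (V : R -> T) (a b c : R) (full : T) :
  (forall S, measurable [set t | V t = S]) ->
  (forall t, t \in `[a, b] -> V t \in A) ->
  full \in A -> 0 <= c ->
  exists2 w, supported_weight A w & forall f : T -> R,
    \int[lebesgue_measure]_(t in `[a, b]) f (V t) + f full * c =
    \sum_S w S * f S.
Proof.
move=> mV VA fullA c0; have [w [w0 wA] wE] := level_integral_weights mV VA.
exists (fun S => w S + (S == full)%:R * c).
  split=> [S|S SA]; first by rewrite addr_ge0// mulr_ge0.
  by rewrite wA// add0r; case: eqVneq SA => [->|_ _]; rewrite ?fullA// mul0r.
move=> f; rewrite wE; under [RHS]eq_bigr do rewrite mulrDl.
rewrite big_split/=; congr +%R; rewrite (bigD1 full)//= eqxx mul1r mulrC.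
by rewrite big1 ?addr0// => S /negbTE ->; rewrite !mul0r.
Qed.

(** The endpoint 1 is a null set. It has to be excluded from the hypothesis because the level set of
    an indicator vector drops to the empty set there. *)
Lemma Rintegral_itv01_cst (R : realType) (g : R -> R) (c : R) :
  (forall t, 0 <= t < 1 -> g t = c) ->
  \int[lebesgue_measure]_(t in `[0, 1]) g t = c.
Proof.
move=> gc.
have gE : {in (`[0, 1[%classic : set R), g =1 cst c}.
  by move=> t; rewrite inE/= in_itv/=; exact: gc.
have mg : measurable_fun (`[0, 1[%classic : set R) g.
  by apply: (eq_measurable_fun (cst c)) => // t t01; rewrite gE.
transitivity (\int[lebesgue_measure]_(t in `[0, 1[) g t).
  by rewrite /Rintegral -integral_itv_bndo_bndc//; exact/measurable_EFinP.
transitivity (\int[lebesgue_measure]_(t in `[0%R, 1%R[) (c : R)).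
  by apply: eq_Rintegral => t /gE.
rewrite Rintegral_cst//.
by rewrite /= lebesgue_measure_itv/= lte_fin ltr01 oppr0 adde0 mulr1.
Qed.

(** The lower bound is the minimum of the indicator vector. If [S] is [full], the interval shrinks
    to a point and the boundary term yields [f S]; otherwise that term vanishes and the integral
    over [0, 1] yields it. *)
Lemma level_integral_indicator (R : realType) (T : finType) (V : R -> T)
    (S full : T) (f : T -> R) :
  (forall t, 0 <= t < 1 -> V t = S) ->
  \int[lebesgue_measure]_(t in `[(S == full)%:R, 1]) f (V t) +
    f full * (S == full)%:R = f S.
Proof.
move=> VS; case: eqVneq => [->|_] /=.
  by rewrite set_itv1 Rintegral_set1 add0r mulr1.
by rewrite mulr0 addr0; apply: Rintegral_itv01_cst => t /VS ->.
Qed.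

(** * Indicator vectors: level sets, extreme coordinates and norms *)

Lemma bigmax_bool (R : realDomainType) (I : finType) (b0 : bool)
    (b : I -> bool) :
  \big[Num.max/b0%:R]_i (b i)%:R = (b0 || [exists i, b i])%:R :> R.
Proof.
have [/existsP[i bi]|/existsPn nb] := boolP [exists i, b i].
  rewrite orbT; apply/eqP; rewrite eq_le; apply/andP; split.
    by apply: bigmax_le => [|j _]; rewrite lern1 leq_b1.
  by apply: (bigmax_sup i); rewrite ?bi.
by rewrite orbF; apply: bigmax_eq_id => i _; rewrite (negbTE (nb i)).
Qed.

Lemma bigmin_bool (R : realDomainType) (I : finType) (b0 : bool)
    (b : I -> bool) :
  \big[Num.min/b0%:R]_i (b i)%:R = (b0 && [forall i, b i])%:R :> R.
Proof.
have [/forallP ab|/forallPn[i nb]] := boolP [forall i, b i].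
  by rewrite andbT; apply: bigmin_eq_id => i _; rewrite ab lern1 leq_b1.
rewrite andbF; apply/eqP; rewrite eq_le; apply/andP; split.
  by apply: (bigmin_inf i); rewrite // (negbTE nb).
by apply: le_bigmin.
Qed.

Definition indicator_row (R : realType) (n : nat) (S : {set 'I_n}) :
    'rV[R]_n :=
  \row_i (i \in S)%:R.

Definition signed_indicator_row (R : realType) (n : nat)
    (S : {set 'I_n} * {set 'I_n}) : 'rV[R]_n :=
  \row_i ((i \in S.1)%:R - (i \in S.2)%:R).

(** Negative levels are included because [lovasz_dom] ranges over all real [t]. *)
Lemma Vt_indicator_row (R : realType) (n : nat) (S : {set 'I_n}) (t : R) :
  Vt t (indicator_row R S) =
  if t < 0 then [set: 'I_n]%SET else if t < 1 then S else finset.set0.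
Proof.
apply/setP => i; rewrite inE mxE; case: (ltP t 0) => t0.
  by rewrite inE (lt_le_trans t0).
by case: (ltP t 1) => t1; case: (i \in S); rewrite ?inE// ltNge ?t0 ?t1.
Qed.

Lemma min_coord_indicator_row (R : realType) (n : nat) (S : {set 'I_n.+1}) :
  min_coord (indicator_row R S) = (S == [set: 'I_n.+1]%SET)%:R.
Proof.
rewrite /min_coord mxE; under eq_bigr do rewrite mxE.
rewrite bigmin_bool; congr (nat_of_bool _)%:R.
apply/andP/eqP => [[_ /forallP aS]|->]; first by apply/setP => i; rewrite aS inE.
by split; [rewrite inE|apply/forallP => i; rewrite inE].
Qed.

Lemma max_coord_indicator_row (R : realType) (n : nat) (S : {set 'I_n.+1}) :
  max_coord (indicator_row R S) = (S != finset.set0)%:R.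
Proof.
rewrite /max_coord mxE; under eq_bigr do rewrite mxE.
rewrite bigmax_bool; congr (nat_of_bool _)%:R.
apply/orP/set0Pn => [[?|/existsP[i]]|[i iS]]; [by exists ord0|by exists i|].
by right; apply/existsP; exists i.
Qed.

(** Disjointness rules out cancellation: each entry is 1 on [S.1], -1 on [S.2] and 0 elsewhere. *)
Lemma Vtpm_signed_indicator_row (R : realType) (n : nat)
    (S : {set 'I_n} * {set 'I_n}) (t : R) :
  S \in P2 n -> 0 <= t ->
  Vtpm t (signed_indicator_row R S) =
  if t < 1 then S else (finset.set0, finset.set0).
Proof.
case: S => P N; rewrite inE /= => /pred0P dPN t0.
have N1 : (t < -1) = false by apply/negbTE; rewrite -leNgt (le_trans _ t0)// lerN10.
rewrite /Vtpm; case: (ltP t 1) => t1; congr pair; apply/setP => i;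
  have := dPN i; rewrite !inE mxE /=; case: (i \in P); case: (i \in N) => //= _;
  by rewrite ?subr0 ?sub0r ?opprK ?oppr0 ?N1 ?t1 // ltNge ?t0 ?t1.
Qed.

Lemma norm_signed_indicator_row (R : realType) (n : nat)
    (S : {set 'I_n} * {set 'I_n}) :
  S \in P2 n ->
  `|signed_indicator_row R S| = (S != (finset.set0, finset.set0))%:R.
Proof.
case: S => P N; rewrite inE /= => /pred0P dPN.
rewrite [LHS]mx_normrE (eq_bigr (fun ij => ((ij.2 \in P) || (ij.2 \in N))%:R));
  last first.
  move=> ij _; rewrite mxE /=; have := dPN ij.2; rewrite /=.
  by case: (_ \in P); case: (_ \in N) => //= _;
    rewrite ?subr0 ?sub0r ?normrN ?normr1 ?normr0.
(* The initial value 0 of the sup norm is read as the Boolean [false]. *)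
rewrite (bigmax_bool R false); congr (nat_of_bool _)%:R => /=.
apply/existsP/idP => [[[_ i] /= iPN]|].
  by apply: contraL iPN => /eqP[-> ->]; rewrite !inE.
rewrite xpair_eqE negb_and => /orP[]/set0Pn[i iS]; exists (ord0, i);
  by rewrite iS ?orbT.
Qed.

(** Puts nonemptiness of a tuple into the existential form that [bigmax_bool] produces. *)
Lemma dffun_neq (k : nat) (T : 'I_k -> finType)
    (S S' : {dffun forall i, T i}) :
  (S != S') = [exists i, S i != S' i].
Proof.
apply/idP/existsP => [|[i]]; last by apply: contraNneq => ->.
move=> SS'; apply/existsP; apply: contraR SS' => /existsPn eqS.
by apply/eqP/ffunP => i; apply/eqP; rewrite -[_ == _]negbK eqS.
Qed.

Definition kindicator (R : realType) (k : nat) (n : 'I_k -> nat)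
    (S : ktuple n) : forall i, 'rV[R]_(n i) := fun i => indicator_row R (S i).

Definition ksigned_indicator (R : realType) (k : nat) (n : 'I_k -> nat)
    (S : ktuple_pair n) : forall i, 'rV[R]_(n i) := fun i => signed_indicator_row R (S i).

Lemma kVt_kindicator (R : realType) (k : nat)
    (n : 'I_k -> nat) (S : ktuple n) (t : R) :
  kVt t (kindicator R S) =
  if t < 0 then kfull n else if t < 1 then S else kempty n.
Proof.
apply/ffunP => i; rewrite ffunE Vt_indicator_row.
by do 2?case: ifP => _; rewrite // ffunE.
Qed.

Lemma kVtpm_ksigned_indicator (R : realType) (k : nat)
    (n : 'I_k -> nat) (S : ktuple_pair n) (t : R) :
  S \in kP2 n -> 0 <= t ->
  kVtpm t (ksigned_indicator R S) = if t < 1 then S else kempty_pair n.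
Proof.
rewrite inE => /forallP SP t0; apply/ffunP => i.
rewrite ffunE (Vtpm_signed_indicator_row (SP i) t0).
by case: ifP => _; rewrite // ffunE.
Qed.

Lemma knorm_ksigned_indicator (R : realType) (k : nat)
    (n : 'I_k -> nat) (S : ktuple_pair n) :
  S \in kP2 n ->
  knorm (ksigned_indicator R S) = (S != kempty_pair n)%:R.
Proof.
rewrite inE => /forallP SP.
rewrite /knorm; under eq_bigr => i _ do rewrite (norm_signed_indicator_row R (SP i)).
rewrite (bigmax_bool R false) (dffun_neq S); congr (nat_of_bool _)%:R => /=.
by apply: eq_existsb => i; rewrite ffunE.
Qed.

Lemma kmin_coord_kindicator (R : realType) (k : nat) (n : 'I_k.+1 -> nat)
    (S : ktuple (fun i => (n i).+1)) :
  kmin_coord (kindicator R S) = (S == kfull (fun i => (n i).+1))%:R.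
Proof.
rewrite /kmin_coord min_coord_indicator_row.
under eq_bigr do rewrite min_coord_indicator_row.
rewrite bigmin_bool; congr (nat_of_bool _)%:R.
apply/andP/eqP => [[_ /forallP aS]|->].
  by apply/ffunP => i; rewrite (eqP (aS i)) ffunE.
by split; [|apply/forallP => i]; rewrite ffunE.
Qed.

Lemma kmax_coord_kindicator (R : realType) (k : nat) (n : 'I_k.+1 -> nat)
    (S : ktuple (fun i => (n i).+1)) :
  kmax_coord (kindicator R S) = (S != kempty (fun i => (n i).+1))%:R.
Proof.
rewrite /kmax_coord max_coord_indicator_row.
under eq_bigr do rewrite max_coord_indicator_row.
rewrite bigmax_bool (dffun_neq S); congr (nat_of_bool _)%:R.
apply/orP/existsP => [[S0|/existsP[i Si]]|[i]]; [exists ord0|exists i|];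
  rewrite ffunE//.
by right; apply/existsP; exists i.
Qed.

(* The Lovasz extension does not depend on the value of f at the empty set, so
   that the identity needs the empty set not to lie in A'.  This holds under
   the usual normalization f_j(empty set) = 0, as 0 is not in Dom(H). *)
Theorem theorem3p1 (R : realType) (m : nat) (H : 'rV[R]_m -> \bar R)
    (H_ninfty : forall a, punctured_orthant a -> H a != -oo%E)
    (H_homo : forall (t : R) a, 0 < t -> punctured_orthant a ->
       H (t *: a) = H a)
    (H_min : forall a b, punctured_orthant a -> punctured_orthant b ->
       (Order.min (H a) (H b) <= H (a + b)%R)%E) :
  [/\ (forall (n : nat) (A : {set {set 'I_n.+1}})
         (f : 'I_m -> {set 'I_n.+1} -> R),
         finset.set0 \in A -> [set: 'I_n.+1]%SET \in A ->
         (forall j S, S \in A -> 0 <= f j S) ->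
         finset.set0 \notin Aprime H A f ->
         min_eq_inf H A f (lovasz_dom A) (fun j => lovasz (f j))),
      (forall (n : nat) (A : {set {set 'I_n} * {set 'I_n}})
         (f : 'I_m -> {set 'I_n} * {set 'I_n} -> R),
         (finset.set0, finset.set0) \in A -> A \subset P2 n ->
         (forall j S, S \in A -> 0 <= f j S) ->
         (finset.set0, finset.set0) \notin Aprime H A f ->
         min_eq_inf H A f (lovasz_pair_dom A) (fun j => lovasz_pair (f j))),
      (forall (k : nat) (n : 'I_k.+1 -> nat)
         (A : {set ktuple (fun i => (n i).+1)})
         (f : 'I_m -> ktuple (fun i => (n i).+1) -> R),
         kempty _ \in A -> kfull _ \in A ->
         (forall j S, S \in A -> 0 <= f j S) ->
         kempty _ \notin Aprime H A f ->
         min_eq_inf H A f (klovasz_dom A) (fun j => klovasz (f j))) &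
      (forall (k : nat) (n : 'I_k -> nat) (A : {set ktuple_pair n})
         (f : 'I_m -> ktuple_pair n -> R),
         kempty_pair n \in A -> A \subset kP2 n ->
         (forall j S, S \in A -> 0 <= f j S) ->
         kempty_pair n \notin Aprime H A f ->
         min_eq_inf H A f (klovasz_pair_dom A) (fun j => klovasz_pair (f j)))].
Proof.
split=> [n A f eA fullA f0 eA'|n A f eA AP f0 eA'|k n A f eA fullA f0 eA'
        |k n A f eA AP f0 eA'];
  apply: (min_eq_inf_of_weights H_ninfty H_homo H_min f0 eA').
(* The extra weight of the full set is [min_coord x], nonnegative because the domain lies in the
   nonnegative orthant. *)
- move=> x [x0 xA]; have min0 : 0 <= min_coord x by apply: le_bigmin.
  have [w [w0 wA] wE] := level_integral_add_weights
    (a := min_coord x) (b := max_coord x) (measurable_Vt x) (fun t _ => xA t) fullA min0.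
  by exists w => // j; exact: wE.
- move=> S SA Se; exists (indicator_row R S) => [|j].
    (* The level sets of the indicator are the full set, [S] and the empty set, all in [A]. *)
    split=> [i|t]; first by rewrite mxE.
    by rewrite Vt_indicator_row; do 2?case: ifP.
  (* As [S] is nonempty, the maximal coordinate is 1. *)
  rewrite /lovasz min_coord_indicator_row max_coord_indicator_row Se.
  apply: level_integral_indicator => t /andP[t0 t1].
  by rewrite Vt_indicator_row ltNge t0 t1.
- move=> x xA.
  (* The domain controls only levels [t >= 0], which cover the interval of integration. *)
  have xA01 t : t \in `[0, `|x|] -> Vtpm t x \in A.
    by rewrite in_itv/= => /andP[/xA].
  have [w [w0 wA] wE] := level_integral_weights (measurable_Vtpm x) xA01.
  by exists w => // j; exact: wE.
- move=> S SA Se; have SP := fintype.subsetP AP _ SA.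
  exists (signed_indicator_row R S) => [t t0|j].
    by rewrite Vtpm_signed_indicator_row//; case: ifP.
  rewrite /lovasz_pair norm_signed_indicator_row// Se.
  apply: Rintegral_itv01_cst => t /andP[t0 t1].
  by rewrite Vtpm_signed_indicator_row// t1.
- move=> x [x0 xA]; have min0 : 0 <= kmin_coord x.
    by apply: le_bigmin => [|i _]; apply: le_bigmin.
  have mV S : measurable [set t : R | kVt t x = S].
    by apply: measurable_dffun => i; exact: measurable_Vt.
  have [w [w0 wA] wE] := level_integral_add_weights
    (a := kmin_coord x) (b := kmax_coord x) mV (fun t _ => xA t) fullA min0.
  by exists w => // j; exact: wE.
- move=> S SA Se; exists (kindicator R S) => [|j].
    split=> [i j|t]; first by rewrite mxE.
    by rewrite kVt_kindicator; do 2?case: ifP.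
  rewrite /klovasz kmin_coord_kindicator kmax_coord_kindicator Se.
  apply: level_integral_indicator => t /andP[t0 t1].
  by rewrite kVt_kindicator ltNge t0 t1.
- move=> x xA.
  have xA01 t : t \in `[0, knorm x] -> kVtpm t x \in A.
    by rewrite in_itv/= => /andP[/xA].
  have mV S : measurable [set t : R | kVtpm t x = S].
    by apply: (@measurable_dffun _ _ _ _ (fun i t => Vtpm t (x i))) => i;
      exact: measurable_Vtpm.
  have [w [w0 wA] wE] := level_integral_weights mV xA01.
  by exists w => // j; exact: wE.
- move=> S SA Se; have SP := fintype.subsetP AP _ SA.
  exists (ksigned_indicator R S) => [t t0|j].
    by rewrite kVtpm_ksigned_indicator//; case: ifP.
  rewrite /klovasz_pair knorm_ksigned_indicator// Se.
  apply: Rintegral_itv01_cst => t /andP[t0 t1].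
  by rewrite kVtpm_ksigned_indicator// t1.
Qed.
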